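(* Let $n\ge1$, $1\le i\le n$ be integers, $\alpha,\beta>0$, $\tau\ge0$ with $i\beta(\tau+1)>\tau$. Put $$a=\frac{(n-i+1)\tau\beta+(n-i+1)\beta+\tau}{\beta},\qquad b=\frac{i\tau\beta+i\beta-\tau}{\beta}.$$ Then $J^{(i)}_\tau(\alpha)=A_1+A_2-A_3$, where $$A_1=\left(\frac{\beta}{\alpha}\right)^{\tau+2}(n-i+1)^2c(i,n)^{\tau+1}B(a,b),$$ $$A_2=\left(\frac{\beta}{\alpha}\right)^{\tau+2}(n+1)^2c(i,n)^{\tau+1}\cdot\frac{(n-i+1)\tau\beta+(n-i+2)\beta+\tau}{\beta[(n+1)\tau+(n+2)]}\cdot\frac{(n-i+1)\tau\beta+(n-i+1)\beta+\tau}{\beta[(n+1)\tau+(n+1)]}\,B(a,b),$$ $$A_3=\left(\frac{\beta}{\alpha}\right)^{\tau+2}2(n-i+1)(n+1)c(i,n)^{\tau+1}\cdot\frac{(n-i+1)\tau\beta+(n-i+1)\beta+\tau}{(n+1)\tau\beta+(n+1)\beta}\,B(a,b).$$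
   Context: For integers $1\le i\le n$, $c(i,n)=\frac{n!}{(n-i)!(i-1)!}$ and $f^{(i)}_{\alpha,\beta}(x)=\frac{c(i,n)\beta (x/\alpha)^{i\beta-1}}{\alpha(1+(x/\alpha)^\beta)^{n+1}}$, $x>0$, is the density of the $i$-th order statistic of a sample of size $n$ from the log-logistic distribution with scale $\alpha>0$ and shape $\beta>0$ (density $\beta\alpha^\beta x^{\beta-1}/(x^\beta+\alpha^\beta)^2$). With $\beta$ regarded as known, $J^{(i)}_\tau(\alpha)=\int_0^\infty\left(\frac{\partial}{\partial\alpha}\log f^{(i)}_{\alpha,\beta}(x)\right)^2 f^{(i)}_{\alpha,\beta}(x)^{\tau+1}\,dx$. $B(a,b)=\int_0^1x^{a-1}(1-x)^{b-1}dx$ is the Beta function. *)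

(* Defs.v *)
From HB Require Import structures.
From mathcomp Require Import all_boot all_order all_algebra.
From mathcomp Require Import all_classical all_reals all_analysis.
Set Implicit Arguments. Unset Strict Implicit. Unset Printing Implicit Defensive.
Import Order.TTheory GRing.Theory Num.Theory.
Import numFieldNormedType.Exports.
Local Open Scope classical_set_scope.
Local Open Scope ring_scope.

Definition cin {R : realType} (i n : nat) : R :=
  (n`!)%:R / (((n - i)`!)%:R * ((i.-1)`!)%:R).

(* density of the i-th order statistic of a size-n log-logistic sample,
   scale al, shape be, at the point x > 0 *)
Definition fos {R : realType} (n i : nat) (al be x : R) : R :=
  cin i n * be * (x / al) `^ (i%:R * be - 1)
  / (al * (1 + (x / al) `^ be) ^+ n.+1).

Definition score {R : realType} (n i : nat) (al be x : R) : R :=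
  derive1 (fun a : R => ln (fos n i a be x)) al.

Definition Jtau {R : realType} (n i : nat) (al be tau : R) : \bar R :=
  (\int[@lebesgue_measure R]_(x in `]0%R, +oo[)
     ((score n i al be x) ^+ 2 * (fos n i al be x) `^ (tau + 1))%:E)%E.

Definition Beta {R : realType} (a b : R) : R :=
  Rintegral (@lebesgue_measure R) `]0%R, 1%R[
    (fun x => x `^ (a - 1) * (1 - x) `^ (b - 1)).

(* Main.v *)
Require Import Defs.
From HB Require Import structures.
From mathcomp Require Import all_boot all_order all_algebra.
From mathcomp Require Import all_classical all_reals all_analysis.
From mathcomp Require Import measurable_realfun ring lra.
Import Order.TTheory GRing.Theory Num.Theory.
Import numFieldNormedType.Exports.
Local Open Scope classical_set_scope.
Local Open Scope ring_scope.

(** The survival function u = 1 / (1 + (x / al)^be) maps ]0, +oo[ decreasingly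
    onto ]0, 1[.  In this variable the score is (be / al) (m - (n + 1) u) with
    m = n - i + 1, and the (tau + 1)-st power of the density is
    (be / al)^tau cin^(tau + 1) u^(a - 1) (1 - u)^(b - 1) |du/dx|, so that Jtau
    is a combination of B(a, b), B(a + 1, b) and B(a + 2, b), to which
    B(a + 1, b) = a / (a + b) B(a, b) applies. *)

(** * Exhaustion of the two open intervals by compact ones *)

Lemma itv0y_bigcup (R : realType) :
  `]0, +oo[%classic = \bigcup_k `[(k.+2%:R : R)^-1, k.+2%:R]%classic.
Proof.
apply/seteqP; split=> [x|x [k _]] /=; rewrite !in_itv/= ?andbT; last first.
  by move=> /andP[+ _]; apply: lt_le_trans; rewrite invr_gt0 ltr0n.
move=> x0; have [N _ NP] : \forall k \near \oo, x <= k%:R by exact: nbhs_infty_ger.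
have [M _ MP] : \forall k \near \oo, x^-1 <= k%:R by exact: nbhs_infty_ger.
exists (N + M)%N => //=; rewrite in_itv/= NP/= ?andbT; last by rewrite -!addnS leq_addr.
rewrite -[leRHS]invrK lef_pV2 ?posrE ?invr_gt0 ?ltr0n// MP//=.
by rewrite -addn2 -addnA addnCA leq_addr.
Qed.

(** The shift by 3 keeps every interval nondegenerate, since 1/(k+3) <= 1/3 < 2/3 <= 1 - 1/(k+3);
    integration by parts later relies on this. *)
Lemma itv01_bigcup (R : realType) :
  `]0, 1[%classic = \bigcup_k `[(k.+3%:R : R)^-1, 1 - k.+3%:R^-1]%classic.
Proof.
apply/seteqP; split=> [x|x [k _]] /=; rewrite !in_itv/=; last first.
  have : 0 < (k.+3%:R : R)^-1 by rewrite invr_gt0 ltr0n.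
  by move: (_^-1) => r ? /andP[? ?]; apply/andP; split; lra.
move=> /andP[x0 x1].
have [N _ NP] : \forall k \near \oo, x^-1 <= k%:R by exact: nbhs_infty_ger.
have [M _ MP] : \forall k \near \oo, (1 - x)^-1 <= k%:R by exact: nbhs_infty_ger.
have x1' : 0 < 1 - x by rewrite subr_gt0.
exists (N + M)%N => //=; rewrite in_itv/=; apply/andP; split.
  rewrite -[leRHS]invrK lef_pV2 ?posrE ?invr_gt0 ?ltr0n// NP//=.
  by rewrite -!addnS leq_addr.
rewrite lerBrDr -lerBrDl -[leRHS]invrK lef_pV2 ?posrE ?invr_gt0 ?ltr0n// MP//=.
by rewrite -addn3 -addnA addnCA leq_addr.
Qed.

(** * Decreasing change of variables on the half-line *)

Section substitution.
Context {R : realType}.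
Notation mu := (@lebesgue_measure R).
Local Open Scope ereal_scope.

(** Monotone convergence for an increasing sequence of compact intervals; continuity supplies
    measurability. It turns identities on compact intervals into identities on open ones, infinite
    values included. *)
Lemma ge0_itv_cvg_integral (a b : R^nat) (f : R -> R) (D : set R) :
  nonincreasing_seq a -> nondecreasing_seq b ->
  D = \bigcup_k `[a k, b k]%classic ->
  {in D, continuous f} -> (forall x, D x -> 0 <= f x)%R ->
  \int[mu]_(x in `[a k, b k]) (f x)%:E @[k --> \oo] --> \int[mu]_(x in D) (f x)%:E.
Proof.
move=> na nb DE cf f0; rewrite DE.
apply: (@ge0_nondecreasing_set_cvg_integral _ (measurableTypeR R) R
  (fun k => `[a k, b k]%classic) (EFin \o f) mu).
- apply/nondecreasing_seqP => k; apply/subsetPset => x /=; rewrite !in_itv/= => /andP[ax xb].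
  by rewrite (le_trans _ ax) ?(le_trans xb)//; [exact: nb|exact: na].
- by move=> k; exact: measurable_itv.
- move=> k; apply/measurable_EFinP; apply: subspace_continuous_measurable_fun => //.
  apply: continuous_in_subspaceT => x; rewrite inE/= => xk; apply: cf.
  by rewrite inE DE; exists k.
- by move=> k x xk; rewrite lee_fin; apply: f0; rewrite DE; exists k.
Qed.

(** The substitution rule is applied on each compact [[a k, b k]], and both sides pass to the limit
    by [ge0_itv_cvg_integral]. Nonnegativity of [G] lets this go through before any integral is
    known to be finite. *)
Lemma decreasing_ge0_integration_by_substitution0y (F G : R -> R) (c d : R) :
  {in `]0%R, +oo[ &, {homo F : x y /~ (x < y)%R}} ->
  {in `]0%R, +oo[, forall x, derivable F x 1} ->
  {in `]0%R, +oo[, continuous (derive1 F)} ->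
  F @` `]0%R, +oo[ = `]c, d[%classic ->
  {in `]c, d[, continuous G} -> {in `]c, d[, forall u, (0 <= G u)%R} ->
  \int[mu]_(u in `]c, d[) (G u)%:E =
  \int[mu]_(x in `]0%R, +oo[) (((G \o F) * - derive1 F) x)%:E.
Proof.
move=> decF dF cF' imF cG G0.
pose a k : R := (k.+2%:R^-1)%R; pose b k : R := (k.+2%:R)%R.
have a0 k : (0 < a k)%R by rewrite /a invr_gt0 ltr0n.
have b0 k : (0 < b k)%R by rewrite /b ltr0n.
have ab k : (a k <= b k)%R.
  by rewrite /a /b (@le_trans _ _ 1%R) ?ler1n// invf_le1 ?ltr0n// ler1n.
have na : nonincreasing_seq a.
  by apply/nonincreasing_seqP => k; rewrite /a lef_pV2 ?posrE ?ltr0n// ler_nat.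
have nb : nondecreasing_seq b.
  by apply/nondecreasing_seqP => k; rewrite /b ler_nat.
have abE : `]0%R, +oo[%classic = \bigcup_k `[a k, b k]%classic by exact: itv0y_bigcup.
(* From here on only positivity, order, monotonicity and the exhaustion property of the endpoints
   matter. *)
clearbody a b.
have wdecF (x y : R) : (0 < y)%R -> (y <= x)%R -> (F x <= F y)%R.
  move=> y0; rewrite le_eqVlt => /predU1P[->//|yx]; apply/ltW/decF => //.
  - by rewrite in_itv/= andbT (lt_trans y0).
  - by rewrite in_itv/= andbT.
have Fin (x : R) : (0 < x)%R -> F x \in `]c, d[.
  move=> x0; have : (F @` `]0%R, +oo[) (F x) by exists x => //=; rewrite in_itv/= x0.
  by rewrite imF.
have subab k x : x \in `[a k, b k] -> x \in `]0%R, +oo[.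
  by rewrite !in_itv/= andbT => /andP[+ _]; exact: lt_le_trans.
have F'le0 (x : R) : x \in `]0%R, +oo[ -> (derive1 F x <= 0)%R.
  move=> x0; apply: (@decr_derive1_le0_itvy _ _ false 0%R).
  - by move=> y; rewrite inE; exact: dF.
  - exact: decF.
  - exact: x0.
have cF (x : R) : x \in `]0%R, +oo[ -> {for x, continuous F}.
  by move=> x0; apply: differentiable_continuous; exact/derivable1_diffP/dF.
have subF k u : u \in `[F (b k), F (a k)] -> u \in `]c, d[.
  move=> /[!in_itv]/= /andP[Fu uF].
  have := Fin _ (a0 k); have := Fin _ (b0 k); rewrite !in_itv/=.
  by move=> /andP[cFb _] /andP[_ Fad]; rewrite (lt_le_trans cFb)// (le_lt_trans uF).
have cvgG : \int[mu]_(u in `[F (b k), F (a k)]) (G u)%:E @[k --> \oo] -->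
    \int[mu]_(u in `]c, d[) (G u)%:E.
  apply: ge0_itv_cvg_integral.
  - by move=> m n mn; apply: wdecF (nb _ _ mn).
  - by move=> m n mn; apply: wdecF (na _ _ mn).
  (* The image intervals exhaust []c, d[]: any u there is some F x, and x lies in one of the
     [[a k, b k]]. *)
  - apply/seteqP; split=> [u|u [k _]] /=; last exact: subF.
    have cdF : `]c, d[%classic `<=` F @` `]0%R, +oo[ by rewrite imF.
    move=> /cdF[x + <-]; rewrite abE => -[k _ /=].
    rewrite in_itv/= => /andP[ax xb].
    by exists k => //=; rewrite in_itv/= !wdecF// (lt_le_trans (a0 k)).
  - by move=> u; rewrite inE; exact: cG.
  - by move=> u; exact: G0.
apply: (cvg_unique _ cvgG) => //.
rewrite (_ : (fun k => _) = (fun k => \int[mu]_(x in `[a k, b k])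
    (((G \o F) * - derive1 F) x)%:E)); last first.
  apply/funext => k; apply: integration_by_substitution_decreasing.
  - exact: ab.
  - by move=> x y xk yk; apply: decF; apply: (subab k).
  - by move=> x xk; apply/cF'/(subab k); exact: subset_itv_oo_cc xk.
  - by apply: cvgP; apply: cvg_at_right_filter; apply: cF'; rewrite in_itv/= a0.
  - by apply: cvgP; apply: cvg_at_left_filter; apply: cF'; rewrite in_itv/= b0.
  - split.
    + by move=> x xk; apply/dF/(subab k); exact: subset_itv_oo_cc xk.
    + by apply: cvg_at_right_filter; apply: cF; rewrite in_itv/= a0.
    + by apply: cvg_at_left_filter; apply: cF; rewrite in_itv/= b0.
  - by apply: continuous_in_subspaceT => u; rewrite inE/= => /subF; exact: cG.
apply: ge0_itv_cvg_integral => //.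
- move=> x /[!inE]/= x0; apply: cvgM; last by apply: cvgN; exact: cF'.
  apply: continuous_comp; first exact: cF.
  by apply/cG/Fin; move: x0; rewrite in_itv/= andbT.
- move=> x /= x0; rewrite mulr_ge0 ?oppr_ge0 ?F'le0//.
  by apply/G0/Fin; move: x0; rewrite in_itv/= andbT.
Qed.

End substitution.

Lemma gt0_powRD {R : realType} (x r s : R) : 0 < x -> x `^ (r + s) = x `^ r * x `^ s.
Proof. by move=> x0; apply: powRD; apply/implyP => _; rewrite gt_eqF. Qed.

(** * The Beta integral: recurrences and finiteness *)

Section beta.
Context {R : realType}.
Notation mu := (@lebesgue_measure R).
Implicit Types (a b : R).

Definition beta_kernel a b (u : R) : R := u `^ (a - 1) * (1 - u) `^ (b - 1).

Lemma beta_kernel_ge0 a b u : 0 <= beta_kernel a b u.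
Proof. by rewrite mulr_ge0// powR_ge0. Qed.

Lemma is_derive1_onem_powR (u p : R) : u < 1 ->
  is_derive u 1 (fun v => (1 - v) `^ p) (- (p * (1 - u) `^ (p - 1))).
Proof.
move=> u1; rewrite (_ : - _ = (p * (1 - u) `^ (p - 1)) * (- 1)); last by rewrite mulrN1.
apply: (@is_derive1_comp _ (fun v => v `^ p) (fun v => 1 - v)).
  by apply: is_derive1_powR; rewrite subr_gt0.
by rewrite -[- 1 in X in is_derive _ _ _ X]sub0r; exact: is_deriveB.
Qed.

Lemma beta_kernel_continuous a b : {in `]0, 1[, continuous (beta_kernel a b)}.
Proof.
move=> u; rewrite in_itv/= => /andP[u0 u1].
apply: differentiable_continuous; apply/derivable1_diffP; apply: derivableM.
  by case: (is_derive1_powR (a - 1) u0).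
by case: (is_derive1_onem_powR _ (b - 1) u1).
Qed.

Lemma measurable_beta_kernel a b :
  measurable_fun (`]0, 1[%classic : set R) (beta_kernel a b).
Proof.
apply: open_continuous_measurable_fun => // u; rewrite inE/=.
exact: beta_kernel_continuous.
Qed.

Lemma onem_beta_kernel a b u : u < 1 ->
  (1 - u) * beta_kernel a b u = beta_kernel a (b + 1) u.
Proof.
move=> u1; rewrite /beta_kernel mulrCA; congr (_ * _).
rewrite (_ : b + 1 - 1 = b - 1 + 1); last by ring.
have u0 : 0 < 1 - u by rewrite subr_gt0.
by rewrite [RHS]gt0_powRD// powRr1 1?mulrC// ltW.
Qed.

Lemma beta_kernelS a b u : 0 < u -> u * beta_kernel a b u = beta_kernel (a + 1) b u.
Proof.
move=> u0; rewrite /beta_kernel mulrA; congr (_ * _).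
rewrite (_ : a + 1 - 1 = a - 1 + 1); last by ring.
by rewrite [RHS]gt0_powRD// powRr1 1?mulrC// ltW.
Qed.

Lemma cvg_powR_onem_powR a b (c : R^nat) : 0 < a -> 0 < b ->
  (forall k, 0 < c k < 1) -> c k @[k --> \oo] --> 0 ->
  c k `^ a * (1 - c k) `^ b @[k --> \oo] --> 0.
Proof.
move=> a0 b0 c01 c0.
have ca : c k `^ a @[k --> \oo] --> 0.
  have /cvg_at_rightP := powR_cvg0 a0; apply; split => // k.
  by case/andP: (c01 k).
apply: (@squeeze_cvgr _ _ _ _ (cst 0) (fun k => c k `^ a)) => //; last exact: cvg_cst.
near=> k; have /andP[ck0 ck1] := c01 k.
rewrite mulr_ge0 ?powR_ge0//= ler_piMr ?powR_ge0//.
have : 0 < 1 - c k <= 1 by apply/andP; split; lra.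
by move=> /ger_powR/(_ 0 b (ltW b0)); rewrite powRr0.
Unshelve. all: by end_near. Qed.

Local Open Scope ereal_scope.

(* As a nonnegative extended integral, so that the identities below hold before
   finiteness is known. *)
Definition ebeta a b := \int[mu]_(u in `]0%R, 1%R[) (beta_kernel a b u)%:E.

(** Multiply the kernel by 1 = u + (1 - u). *)
Lemma ebeta_split a b : ebeta a b = ebeta (a + 1) b + ebeta a (b + 1).
Proof.
rewrite -ge0_integralD//=.
- apply: eq_integral => u; rewrite inE/= in_itv/= => /andP[u0 u1].
  rewrite -beta_kernelS// -onem_beta_kernel// -EFinD; congr EFin; ring.
- by move=> u _; rewrite lee_fin beta_kernel_ge0.
- by apply/measurable_EFinP; exact: measurable_beta_kernel.
- by move=> u _; rewrite lee_fin beta_kernel_ge0.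
- by apply/measurable_EFinP; exact: measurable_beta_kernel.
Qed.

(** Fundamental theorem of calculus for [h], that is u^a (1 - u)^b, whose derivative is the
    difference of the two integrands. *)
Lemma integral_beta_kernel_parts a b (c d : R) : (0 < c)%R -> (c < d)%R -> (d < 1)%R ->
  \int[mu]_(u in `[c, d]) (a * beta_kernel a (b + 1) u)%:E =
  (d `^ a * (1 - d) `^ b - c `^ a * (1 - c) `^ b)%:E +
  \int[mu]_(u in `[c, d]) (b * beta_kernel (a + 1) b u)%:E.
Proof.
move=> c0 cd d1.
pose h (u : R) : R := (u `^ a * (1 - u) `^ b)%R.
have sub (u : R) : u \in `[c, d] -> u \in `]0%R, 1%R[.
  by rewrite !in_itv/= => /andP[cu ud]; rewrite (lt_le_trans c0)//= (le_lt_trans ud).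
have dh (u : R) : u \in `]0%R, 1%R[ -> is_derive u 1%R h
    (a * beta_kernel a (b + 1) u - b * beta_kernel (a + 1) b u)%R.
  rewrite in_itv/= => /andP[u0 u1].
  have h1 := is_derive1_powR a u0; have h2 := is_derive1_onem_powR _ b u1.
  rewrite (_ : (_ - _)%R = u `^ a *: (- (b * (1 - u) `^ (b - 1))) +
    (1 - u) `^ b *: (a * u `^ (a - 1)))%R; first exact: is_deriveM.
  by rewrite /beta_kernel !addrK /GRing.scale/=; ring.
have ck p q (r : R) : {within `[c, d], continuous (fun u => r * beta_kernel p q u)%R}.
  apply: continuous_in_subspaceT => u; rewrite inE/= => /sub u01.
  by apply: cvgM; [exact: cvg_cst|exact: beta_kernel_continuous].
have ik p q (r : R) : mu.-integrable `[c, d] (EFin \o (fun u => r * beta_kernel p q u)%R).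
  by apply: continuous_compact_integrable => //; exact: segment_compact.
pose k1 u := (a * beta_kernel a (b + 1) u)%R.
pose k2 u := (b * beta_kernel (a + 1) b u)%R.
rewrite -[RHS]/((h d - h c)%:E + \int[mu]_(u in `[c, d]) (k2 u)%:E).
(* Both kernels are continuous on the compact [[c, d]], so their integrals are finite and the one of
   [k2] may be cancelled in the extended reals. *)
suff <- : \int[mu]_(u in `[c, d]) (k1 u - k2 u)%:E = (h d - h c)%:E.
  under [X in _ = X + _]eq_integral do rewrite EFinB.
  rewrite integralB_EFin//; [|exact: ik..].
  by rewrite subeK//; apply: integrable_fin_num => //; exact: ik.
apply: continuous_FTC2 => //.
- by move=> u; apply: continuousB; [exact: ck|exact: ck].
- split.
  + by move=> u ucd; case: (dh u (sub _ (subset_itv_oo_cc ucd))).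
  + apply: cvg_at_right_filter; apply: differentiable_continuous.
    by apply/derivable1_diffP; case: (dh c) => //; rewrite in_itv/= c0 (lt_trans cd).
  + apply: cvg_at_left_filter; apply: differentiable_continuous.
    by apply/derivable1_diffP; case: (dh d) => //; rewrite in_itv/= d1 (lt_trans c0).
- move=> u ucd; rewrite derive1E.
  by have /@derive_val := dh u (sub _ (subset_itv_oo_cc ucd)).
Qed.

Lemma ebeta_ge0 a b : 0 <= ebeta a b.
Proof. by apply: integral_ge0 => u _; rewrite lee_fin beta_kernel_ge0. Qed.

(** Limit of the compact identity along [[c k, 1 - c k]], where both boundary terms tend to 0. *)
Lemma ebeta_parts a b : (0 < a)%R -> (0 < b)%R ->
  a%:E * ebeta a (b + 1) = b%:E * ebeta (a + 1) b.
Proof.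
move=> a0 b0; pose c k : R := (k.+3%:R^-1)%R.
have c01 k : (0 < c k < 1)%R by rewrite /c invr_gt0 ltr0n/= invf_lt1 ?ltr0n ?ltr1n.
have onemc01 k : (0 < 1 - c k < 1)%R.
  by have /andP[? ?] := c01 k; apply/andP; split; lra.
have cd k : (c k < 1 - c k)%R.
  suff : (c k <= 3^-1)%R by lra.
  by rewrite /c lef_pV2 ?posrE ?ltr0n// ler_nat.
have c_cvg0 : c k @[k --> \oo] --> 0%R.
  have := @cvg_harmonic R; rewrite -cvg_shiftS -cvg_shiftS; exact.
have cvg_scaled p q (r : R) : (0 <= r)%R ->
    \int[mu]_(u in `[c k, (1 - c k)%R]) (r * beta_kernel p q u)%:E @[k --> \oo]
    --> r%:E * ebeta p q.
  move=> r0; rewrite /ebeta -ge0_integralZl//=; last 2 first.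
  - by apply/measurable_EFinP; exact: measurable_beta_kernel.
  - by move=> u _; rewrite lee_fin beta_kernel_ge0.
  have nc : nonincreasing_seq c.
    by apply/nonincreasing_seqP => k; rewrite /c lef_pV2 ?posrE ?ltr0n// ler_nat.
  apply: (@ge0_itv_cvg_integral _ c (fun k => 1 - c k)%R
    (fun u => r * beta_kernel p q u)%R
    `]0%R, 1%R[%classic nc).
  - by move=> m n mn; rewrite lerD2l lerN2 nc.
  - exact: itv01_bigcup.
  - move=> u; rewrite inE/= => u01.
    by apply: cvgM; [exact: cvg_cst|exact: beta_kernel_continuous].
  - by move=> u _; rewrite mulr_ge0// beta_kernel_ge0.
apply: (cvg_unique _ (cvg_scaled a (b + 1)%R a (ltW a0))) => //.
have parts k := @integral_beta_kernel_parts a b _ _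
  (proj1 (andP (c01 k))) (cd k) (proj2 (andP (onemc01 k))).
rewrite /=; under eq_cvg => k do rewrite parts.
rewrite -[b%:E * _]add0e; apply: cvgeD => //.
- apply: cvg_EFin; first exact: nearW.
  rewrite -(subr0 0%R); apply: cvgB.
    (* The boundary term at 1 - c is the one at c with the exponents a and b exchanged. *)
    under eq_cvg => k do rewrite mulrC subKr.
    exact: cvg_powR_onem_powR.
  exact: cvg_powR_onem_powR.
- exact: cvg_scaled (ltW b0).
Qed.

(* [ebeta (a + 1) (b + 1)] is at most 1, and [ebeta_split] and [ebeta_parts]
   carry finiteness down to [ebeta a b]. *)
Lemma ebeta_lt_pinfty a b : (0 < a)%R -> (0 < b)%R -> ebeta a b < +oo.
Proof.
move=> a0 b0.
have fin11 : ebeta (a + 1) (b + 1) < +oo.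
  apply: (@le_lt_trans _ _ (\int[mu]_(u in `]0%R, 1%R[) 1)).
    apply: ge0_le_integral => //.
    - by move=> u _; rewrite lee_fin beta_kernel_ge0.
    - by apply/measurable_EFinP; exact: measurable_beta_kernel.
    - move=> u /=; rewrite in_itv/= => /andP[u0 u1]; rewrite lee_fin.
      have powR_le1 (x p : R) : (0 < x <= 1 -> 0 < p -> x `^ (p + 1 - 1) <= 1)%R.
        by move=> x01 p0; rewrite addrK -(powRr0 x) ger_powR// ltW.
      by rewrite mulr_ile1 ?powR_ge0// powR_le1// ?subr_gt0 ?u0 ?u1 ?(ltW u1)//=; lra.
  by rewrite integral_cst//= mul1e lebesgue_measure_itv/= lte_fin ltr01 -EFinB ltry.
have finM (r : R) x y : (0 < r)%R -> r%:E * x = y -> 0 <= x -> y < +oo -> x < +oo.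
  by move=> r0 <-; case: x => [x||]//= _; rewrite ?ltry// gt0_muley ?lte_fin.
have a1 : (0 < a + 1)%R by rewrite addr_gt0.
have fin21 : ebeta (a + 1 + 1) b < +oo.
  apply: (finM b) (ebeta_ge0 _ _) _; [exact: b0|exact/esym/ebeta_parts|].
  by rewrite lte_mul_pinfty ?lee_fin ?ltW.
have fin1 : ebeta (a + 1) b < +oo.
  by rewrite ebeta_split; apply: lte_add_pinfty; [exact: fin21|exact: fin11].
rewrite ebeta_split; apply: lte_add_pinfty; first exact: fin1.
apply: (finM a) (ebeta_ge0 _ _) _; [exact: a0|exact/ebeta_parts|].
by rewrite lte_mul_pinfty ?lee_fin ?ltW.
Qed.

Lemma integrable_beta_kernel a b : (0 < a)%R -> (0 < b)%R ->
  mu.-integrable `]0%R, 1%R[ (EFin \o beta_kernel a b).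
Proof.
move=> a0 b0; apply/integrableP; split.
  by apply/measurable_EFinP; exact: measurable_beta_kernel.
under eq_integral => u _ do rewrite gee0_abs ?lee_fin ?beta_kernel_ge0//.
exact: ebeta_lt_pinfty.
Qed.

Lemma EFin_Beta a b : (0 < a)%R -> (0 < b)%R -> (Beta a b)%:E = ebeta a b.
Proof.
move=> a0 b0; rewrite fineK//.
by apply: integrable_fin_num => //; exact: integrable_beta_kernel.
Qed.

(** With x, y, z for B(a, b), B(a + 1, b), B(a, b + 1), the relations x = y + z and a z = b y give
    (a + b) y = a x. Finiteness allows them to be read in the reals. *)
Lemma Beta_addl1 a b : (0 < a)%R -> (0 < b)%R ->
  Beta (a + 1) b = (a / (a + b) * Beta a b)%R.
Proof.
move=> a0 b0; have a1 : (0 < a + 1)%R by rewrite addr_gt0.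
have b1 : (0 < b + 1)%R by rewrite addr_gt0.
have ab : (a + b)%R != 0%R by rewrite gt_eqF// addr_gt0.
have := ebeta_split a b; have := ebeta_parts a b a0 b0.
rewrite -(EFin_Beta _ _ a0 b0) -(EFin_Beta _ _ a1 b0) -(EFin_Beta _ _ a0 b1).
move: (Beta a b) (Beta (a + 1) b) (Beta a (b + 1)) => x y z.
rewrite -!EFinM -EFinD => -[eqab] [->].
by rewrite -[LHS](mulKf ab) mulrDl -eqab; field.
Qed.
End beta.

(** * The log-logistic survival function as a change of variable *)

Section loglogistic.
Context {R : realType}.
Notation mu := (@lebesgue_measure R).
Implicit Types (al be x : R).

Definition llsurv al be x : R := (1 + (x / al) `^ be)^-1.

Lemma onem_llsurv al be x : 1 - llsurv al be x = (x / al) `^ be * llsurv al be x.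
Proof.
rewrite /llsurv; have : 1 + (x / al) `^ be != 0.
  by rewrite gt_eqF// ltr_pwDl// powR_ge0.
by move=> ?; field.
Qed.

Lemma llsurv_itv al be x : 0 < al -> 0 < x -> llsurv al be x \in `]0, 1[.
Proof.
move=> al0 x0; have y0 : 0 < (x / al) `^ be by rewrite powR_gt0// divr_gt0.
have s0 : 0 < 1 + (x / al) `^ be by rewrite addr_gt0.
by rewrite in_itv/= /llsurv invr_gt0 invf_lt1// s0/= ltrDl.
Qed.

Lemma decreasing_llsurv al be : 0 < al -> 0 < be ->
  {in `]0, +oo[ &, {homo llsurv al be : x y /~ x < y}}.
Proof.
move=> al0 be0 x y; rewrite !in_itv/= !andbT => x0 y0 xy.
have pos z : 0 < 1 + (z / al) `^ be by rewrite ltr_pwDl// powR_ge0.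
rewrite /llsurv ltf_pV2 ?posrE ?pos// ltrD2l gt0_ltr_powR ?nnegrE ?divr_ge0 ?ltW//.
by rewrite ltr_pM2r ?invr_gt0.
Qed.

Lemma image_llsurv al be : 0 < al -> 0 < be ->
  llsurv al be @` `]0, +oo[ = `]0, 1[%classic.
Proof.
move=> al0 be0; apply/seteqP; split=> [_ [x + <-]|u] /=.
  move=> xpos; have x0 : 0 < x by move: xpos; rewrite /= in_itv/= andbT.
  by have := llsurv_itv _ be _ al0 x0; rewrite in_itv.
rewrite in_itv/= => /andP[u0 u1].
have w0 : 0 < u^-1 - 1 by rewrite subr_gt0 invf_gt1.
(* The quantile: the solution x of 1 + (x / al)^be = 1 / u. *)
exists (al * (u^-1 - 1) `^ be^-1).
  by rewrite in_itv/= andbT mulr_gt0// powR_gt0.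
rewrite /llsurv mulrAC divff ?gt_eqF// mul1r -powRrM mulVf ?gt_eqF//.
by rewrite powRr1 ?ltW// addrC subrK invrK.
Qed.

Lemma is_derive1_powR_div (c p x : R) : 0 < c -> 0 < x ->
  is_derive x 1 (fun z => (z / c) `^ p) (p * (x / c) `^ (p - 1) / c).
Proof.
move=> c0 x0; apply: (@is_derive1_comp _ (fun z => z `^ p) (fun z => z / c)).
  by apply: is_derive1_powR; rewrite divr_gt0.
have := is_deriveM (is_derive_id x 1) (is_derive_cst c^-1 x 1).
by rewrite scaler0 add0r /GRing.scale/= mulr1.
Qed.

(** Minus the log-logistic density; for x > 0 it is the derivative of [llsurv]. *)
Definition llsurv' al be x : R :=
  - ((be / al) * (x / al) `^ (be - 1) * llsurv al be x ^+ 2).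

Lemma is_derive1_llsurv al be x : 0 < al -> 0 < x ->
  is_derive x 1 (llsurv al be) (llsurv' al be x).
Proof.
move=> al0 x0.
have pos : 1 + (x / al) `^ be != 0 by rewrite gt_eqF// ltr_pwDl// powR_ge0.
have d2 := is_derive1_powR_div al be x al0 x0.
have d3 := is_deriveD (is_derive_cst (1 : R) x 1) d2.
have d4 := @is_deriveV _ (cst 1 + _) x _ 1 pos d3.
rewrite (_ : llsurv' al be x = - (1 + (x / al) `^ be) ^- 2 *:
  (0 + be * (x / al) `^ (be - 1) / al)); first exact: d4.
by rewrite /llsurv' /llsurv /GRing.scale/= exprVn; ring.
Qed.

Lemma llsurv'_continuous al be : 0 < al -> {in `]0, +oo[, continuous (llsurv' al be)}.
Proof.
move=> al0 x; rewrite in_itv/= andbT => x0.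
have d2 := is_derive1_powR_div al (be - 1) x al0 x0.
have cont (f : R -> R) : derivable f x 1 -> {for x, continuous f}.
  by move=> df; apply: differentiable_continuous; exact/derivable1_diffP.
apply: cvgN; apply: cvgM; [apply: cvgM; first exact: cvg_cst|].
  by apply: cont; case: d2.
rewrite (_ : (fun z => _) = (fun z => llsurv al be z * llsurv al be z)).
  by apply: cvgM; apply: cont; case: (is_derive1_llsurv _ be _ al0 x0).
by apply/funext => z; rewrite expr2.
Qed.

Lemma integration_by_substitution_llsurv al be (G : R -> R) : 0 < al -> 0 < be ->
  {in `]0, 1[, continuous G} -> {in `]0, 1[, forall u, 0 <= G u} ->
  (\int[mu]_(u in `]0%R, 1%R[) (G u)%:E =
  \int[mu]_(x in `]0%R, +oo[) (G (llsurv al be x) * - llsurv' al be x)%:E)%E.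
Proof.
move=> al0 be0 cG G0.
have dE x : x \in `]0, +oo[ -> derive1 (llsurv al be) x = llsurv' al be x.
  rewrite in_itv/= andbT derive1E => x0.
  by have /@derive_val := is_derive1_llsurv _ be _ al0 x0.
rewrite (@decreasing_ge0_integration_by_substitution0y _ (llsurv al be))//.
- by apply: eq_integral => x; rewrite inE/= => x0; rewrite !fctE dE.
- exact: decreasing_llsurv.
- move=> x; rewrite in_itv/= andbT => x0.
  by case: (is_derive1_llsurv _ be _ al0 x0).
(* [derive1] is identified with [llsurv'] on the half-line only; this is a neighbourhood of x, so
   continuity transfers by near equality. *)
- move=> x x0; rewrite /continuous_at dE//.
  have := llsurv'_continuous _ be al0 _ x0; apply: cvg_trans; apply: near_eq_cvg.
  near=> y; rewrite dE// in_itv/= andbT; near: y; apply: lt_nbhsr.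
  by move: x0; rewrite in_itv/= andbT.
- exact: image_llsurv.
Unshelve. all: by end_near. Qed.
End loglogistic.

(** * Score and powers of the order statistic density *)

Section order_statistics.
Context {R : realType}.
Implicit Types (al be x : R).

Lemma cin_gt0 i n : 0 < cin i n :> R.
Proof. by rewrite divr_gt0 ?mulr_gt0 ?ltr0n ?fact_gt0. Qed.

Lemma llsurvE al be x : 0 < al -> 0 < x ->
  llsurv al be x = al `^ be / (al `^ be + x `^ be).
Proof.
move=> al0 x0; have ab0 := powR_gt0 be al0; have xb0 := powR_gt0 be x0.
have d0 : al `^ be + x `^ be != 0 by rewrite gt_eqF// addr_gt0.
have n0 : al `^ be != 0 by rewrite gt_eqF.
have q : (x / al) `^ be = x `^ be / al `^ be.
  by rewrite powRM ?invr_ge0 ?ltW// -powR_inv1 ?ltW// -powRrM mulN1r powRN.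
by rewrite /llsurv q; field; rewrite n0 d0.
Qed.

(** Clearing the quotient x / al leaves [al] only in [ln al] and in [ln (al]^ be + x [^ be)], which
    makes differentiation in [al] direct. *)
Lemma ln_fos n i al be x : 0 < al -> 0 < be -> 0 < x ->
  ln (fos n i al be x) = ln (cin i n * be) + (i%:R * be - 1) * ln x
    + (n.+1%:R - i%:R) * be * ln al - n.+1%:R * ln (al `^ be + x `^ be).
Proof.
move=> al0 be0 x0; have y0 : 0 < x / al by rewrite divr_gt0.
have ab0 := powR_gt0 be al0; have xb0 := powR_gt0 be x0.
have y1 := powR_gt0 be y0; have y2 := powR_gt0 (i%:R * be - 1) y0.
have s0 : 0 < 1 + (x / al) `^ be by rewrite addr_gt0.
have sE : 1 + (x / al) `^ be = (al `^ be + x `^ be) / al `^ be.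
  by rewrite -[LHS]invrK -[in LHS]/(llsurv al be x) llsurvE// invf_div.
have sum0 : 0 < al `^ be + x `^ be by rewrite addr_gt0.
have c0 := cin_gt0 i n; have cb0 : 0 < cin i n * be by rewrite mulr_gt0.
rewrite /fos ln_div ?posrE ?mulr_gt0 ?exprn_gt0//.
rewrite [in ln (_ * _ `^ _)]lnM ?posrE// ln_powR [in ln (al * _)]lnM ?posrE ?exprn_gt0//.
rewrite lnXn// sE !ln_div ?posrE// ln_powR -mulr_natl; ring.
Qed.

Lemma scoreE n i al be x : 0 < al -> 0 < be -> 0 < x ->
  score n i al be x = be / al * (n.+1%:R - i%:R - n.+1%:R * llsurv al be x).
Proof.
move=> al0 be0 x0; rewrite /score derive1E.
have ab0 := powR_gt0 be al0; have xb0 := powR_gt0 be x0.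
have sum0 : 0 < al `^ be + x `^ be by rewrite addr_gt0.
(* The expansion of the logarithm is available for positive a, hence in a neighbourhood of [al],
   which is enough for the derivative. *)
rewrite (@near_eq_derive _ _ _ _ (fun a =>
  (ln (cin i n * be) + (i%:R * be - 1) * ln x)
    + (n.+1%:R - i%:R) * be * ln a + - n.+1%:R * ln (a `^ be + x `^ be))) //; last first.
  near=> a; rewrite mulNr; apply: ln_fos => //.
  by near: a; exact: lt_nbhsr.
have d1 := is_derive1_ln al0.
have d2 := is_deriveD (is_derive1_powR be al0) (is_derive_cst (x `^ be) al 1).
have d3 := @is_derive1_comp _ (@ln R) _ al _ _ (is_derive1_ln sum0) d2.
have d4 := is_deriveZ ((n.+1%:R - i%:R) * be) d1.
have d5 := is_deriveZ (- n.+1%:R) d3.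
have d6 := is_deriveD (is_deriveD
  (is_derive_cst (ln (cin i n * be) + (i%:R * be - 1) * ln x) al 1) d4) d5.
have /@derive_val -> := d6.
rewrite llsurvE// /GRing.scale/= gt0_powRD// powR_inv1 ?ltW//.
by field; rewrite !gt_eqF.
Unshelve. all: by end_near. Qed.

(** One factor |du/dx| is split off for the substitution. The shifts by tau / be compensate the
    powers of x / al, as 1 - u = (x / al)^be u. *)
Lemma fos_powR n i al be tau x : (i <= n)%N -> 0 < al -> 0 < be -> 0 < x ->
  fos n i al be x `^ (tau + 1) =
  (be / al) `^ tau * cin i n `^ (tau + 1) *
  (beta_kernel ((n - i + 1)%:R * (tau + 1) + tau / be)
     (i%:R * (tau + 1) - tau / be) (llsurv al be x) * - llsurv' al be x).
Proof.
move=> lein al0 be0 x0; have y0 : 0 < x / al by rewrite divr_gt0.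
rewrite /beta_kernel onem_llsurv /llsurv' opprK.
have s0 : 0 < 1 + (x / al) `^ be by rewrite ltr_pwDl// powR_ge0.
have -> : llsurv al be x = (1 + (x / al) `^ be) `^ (-1) by rewrite powR_inv1 ?ltW.
have -> : fos n i al be x = cin i n * (be / al) * (x / al) `^ (i%:R * be - 1) *
    (1 + (x / al) `^ be) `^ (- n.+1%:R).
  rewrite powR_invn ?ltW// /fos; field.
  by rewrite !gt_eqF// exprn_gt0.
rewrite -powR_mulrn ?powR_ge0//.
move: (1 + _) s0 => s s0; move: (x / al) y0 => y y0.
move: (cin i n) (cin_gt0 i n) => c c0.
have : 0 < be / al by rewrite divr_gt0.
move: (be / al) => q q0.
(* Both sides are positive monomials in c, q, y and s with real exponents, so taking logarithms
   leaves a linear identity in their logarithms. *)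
apply: ln_inj; rewrite ?posrE ?mulr_gt0 ?powR_gt0 ?mulr_gt0 ?powR_gt0//.
do ![rewrite ln_powR | rewrite lnM ?posrE ?mulr_gt0 ?powR_gt0 ?mulr_gt0 ?powR_gt0//].
rewrite natrD natrB// -natr1; field.
by rewrite gt_eqF.
Qed.
End order_statistics.

(** * Integration against the Beta kernel and conclusion *)

Lemma integral_quadratic_beta_kernel (R : realType) (p q r a b : R) :
  0 < a -> 0 < b ->
  (\int[@lebesgue_measure R]_(u in `]0%R, 1%R[)
    ((p + q * u + r * u ^+ 2) * beta_kernel a b u)%:E =
  ((p + q * (a / (a + b)) + r * ((a + 1) / (a + b + 1) * (a / (a + b))))
    * Beta a b)%:E)%E.
Proof.
move=> a0 b0; have a1 : 0 < a + 1 by rewrite addr_gt0.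
have a2 : 0 < a + 1 + 1 by rewrite addr_gt0.
have int_scaled (s a' : R) : 0 < a' -> (@lebesgue_measure R).-integrable `]0%R, 1%R[
    (fun u => s%:E * (beta_kernel a' b u)%:E)%E.
  by move=> a'0; apply: integrableZl => //; exact: integrable_beta_kernel.
have i0 := int_scaled p _ a0; have i1 := int_scaled q _ a1.
have i2 := int_scaled r _ a2.
transitivity (\int[@lebesgue_measure R]_(u in `]0%R, 1%R[)
  (p%:E * (beta_kernel a b u)%:E + q%:E * (beta_kernel (a + 1) b u)%:E
    + r%:E * (beta_kernel (a + 1 + 1) b u)%:E))%E.
  apply: eq_integral => u; rewrite inE/= in_itv/= => /andP[u0 _].
  rewrite -!beta_kernelS// -!EFinM -!EFinD; congr EFin; ring.
rewrite integralD//; last exact: integrableD.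
rewrite integralD// !integralZl//; try exact: integrable_beta_kernel.
rewrite -!/(ebeta _ _) -!EFin_Beta// -!EFinM -!EFinD !Beta_addl1//.
rewrite (addrAC a 1 b); congr EFin; ring.
Qed.

Theorem theorem3 (R : realType) (n i : nat) (al be tau : R) :
  (1 <= n)%N -> (1 <= i)%N -> (i <= n)%N ->
  0 < al -> 0 < be -> 0 <= tau -> tau < i%:R * be * (tau + 1) ->
  let m : R := (n - i + 1)%:R in
  let a : R := (m * tau * be + m * be + tau) / be in
  let b : R := (i%:R * tau * be + i%:R * be - tau) / be in
  let K : R := (be / al) `^ (tau + 2) * (cin i n) `^ (tau + 1) in
  let A1 : R := K * m ^+ 2 * Beta a b in
  let A2 : R := K * (n.+1)%:R ^+ 2
      * ((m * tau * be + (n - i + 2)%:R * be + tau)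
           / (be * ((n.+1)%:R * tau + (n.+2)%:R)))
      * ((m * tau * be + m * be + tau)
           / (be * ((n.+1)%:R * tau + (n.+1)%:R)))
      * Beta a b in
  let A3 : R := K * 2 * m * (n.+1)%:R
      * ((m * tau * be + m * be + tau)
           / ((n.+1)%:R * tau * be + (n.+1)%:R * be))
      * Beta a b in
  Jtau n i al be tau = (A1 + A2 - A3)%:E.
Proof.
move=> _ _ lein al0 be0 tau0 tauib m a b K A1 A2 A3.
have be_neq0 : be != 0 by rewrite gt_eqF.
have mE : m = n.+1%:R - i%:R by rewrite /m natrD natrB// -natr1; ring.
have m0 : 0 < m by rewrite ltr0n addn1.
have t0 : 0 < tau + 1 by rewrite ltr_pwDr.
have a0 : 0 < a.
  rewrite divr_gt0// -addrA ltr_wpDl ?mulr_ge0 ?(ltW m0) ?(ltW be0)//.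
  by rewrite ltr_pwDl// mulr_gt0.
(* The hypothesis relating [tau] to [i] and [be] is exactly the positivity of b, that is,
   integrability at u = 1 (x near 0). *)
have b0 : 0 < b.
  rewrite divr_gt0// subr_gt0; apply: (lt_le_trans tauib).
  by rewrite le_eqVlt; apply/orP; left; apply/eqP; ring.
have aE : a = m * (tau + 1) + tau / be by rewrite /a; field.
have bE : b = i%:R * (tau + 1) - tau / be by rewrite /b; field.
(* The terms tau / be cancel, which explains the denominators of [A2] and [A3]. *)
have abE : a + b = n.+1%:R * (tau + 1) by rewrite aE bE mE; ring.
(* The exponent tau + 2 in [K] collects (be / al)^2 from the squared score and (be / al)^tau from
   the density. *)
pose G u := K * ((m - n.+1%:R * u) ^+ 2 * beta_kernel a b u).
transitivity (\int[@lebesgue_measure R]_(x in `]0%R, +oo[)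
    (G (llsurv al be x) * - llsurv' al be x)%:E)%E.
  apply: eq_integral => x; rewrite inE/= in_itv/= andbT => x0; congr EFin.
  rewrite scoreE// fos_powR// -/m -aE -bE -mE /G /K.
  rewrite gt0_powRD ?divr_gt0// powR_mulrn ?divr_ge0 ?ltW//; ring.
rewrite -integration_by_substitution_llsurv//; last 2 first.
- move=> u u01; apply: cvgM; first exact: cvg_cst.
  apply: cvgM; last exact: beta_kernel_continuous.
  rewrite (_ : (fun v => _) = (fun v => (m - n.+1%:R * v) * (m - n.+1%:R * v))).
    have cG : v @[v --> u] --> u -> m - n.+1%:R * v @[v --> u] --> m - n.+1%:R * u.
      by move=> ?; apply: cvgB; [exact: cvg_cst|apply: cvgM => //; exact: cvg_cst].
    by apply: cvgM; apply: cG; exact: cvg_id.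
  by apply/funext => v; rewrite expr2.
- move=> u _; rewrite /G mulr_ge0//; first by rewrite mulr_ge0 ?powR_ge0.
  by rewrite mulr_ge0 ?sqr_ge0 ?beta_kernel_ge0.
(* Expanding the square: the constant, linear and quadratic coefficients yield [A1], [- A3] and [A2]
   respectively. *)
transitivity (\int[@lebesgue_measure R]_(u in `]0%R, 1%R[)
    ((K * m ^+ 2 + - (K * 2 * m * n.+1%:R) * u + K * n.+1%:R ^+ 2 * u ^+ 2)
      * beta_kernel a b u)%:E)%E.
  by apply: eq_integral => u _; congr EFin; rewrite /G; ring.
rewrite integral_quadratic_beta_kernel// abE; congr EFin.
have n0 : 0 < n.+1%:R :> R by rewrite ltr0n.
rewrite /A1 /A2 /A3 -[n.+2%:R]natr1 (_ : (n - i + 2)%:R = m + 1); last first.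
  by rewrite /m !natrD; ring.
(* Only the occurrences of [a] outside [Beta a b] are unfolded, so that [field] treats [Beta a b] as
   an atom. *)
rewrite {1 2 3}/a; move: n.+1%:R n0 => N N0.
have N1 : 0 < N * tau + (N + 1) by rewrite ltr_wpDl ?mulr_ge0 ?addr_gt0 ?(ltW N0).
have NN := ltW N0; have be1 := ltW be0.
field; rewrite be_neq0 !gt_eqF//= addrC ltr_pwDl ?mulr_ge0 ?mulr_gt0//.
Qed.
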